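(* Let $(A,\cdot,\Delta)$ be an ASI bialgebra and let $\partial\colon A\to A$ be a linear map. Then $\partial$ is a derivation on the ASI bialgebra $(A,\cdot,\Delta)$ if and only if $(\partial,-\partial)$ is a coherent derivation on $(A,\cdot,\Delta)$.
   Context: All vector spaces and algebras are finite-dimensional over a field $\mathbb F$ of characteristic $0$; ''algebra'' means associative algebra, not necessarily unital. $\sigma(a\otimes b)=b\otimes a$; $L_A(a)b=a\cdot b=R_A(b)a$. ASI bialgebra $(A,\cdot,\Delta)$: $(A,\cdot)$ is an algebra, $(A,\Delta)$ is a coassociative coalgebra (counit not required), and for all $a,b\in A$ $$\Delta(a\cdot b)=(R_A(b)\otimes\mathrm{id})\Delta(a)+(\mathrm{id}\otimes L_A(a))\Delta(b),$$ $$(L_A(a)\otimes\mathrm{id}-\mathrm{id}\otimes R_A(a))\Delta(b)=\sigma\big((\mathrm{id}\otimes R_A(b)-L_A(b)\otimes\mathrm{id})\Delta(a)\big).$$ A coderivation of $(A,\Delta)$ is a linear map $\eth\colon A\to A$ with $\Delta\eth=(\eth\otimes\mathrm{id}+\mathrm{id}\otimes\eth)\Delta$. A derivation on the ASI bialgebra $(A,\cdot,\Delta)$ is a linear map $\partial\colon A\to A$ that is both a derivation of the algebra $(A,\cdot)$ and a coderivation of the coalgebra $(A,\Delta)$. A coherent derivation on $(A,\cdot,\Delta)$ is a pair $(\partial,\eth)$ with $\partial$ a derivation of $(A,\cdot)$ and $\eth$ a coderivation of $(A,\Delta)$ such that for all $a,b\in A$: $\eth(a)\cdot b=a\cdot\partial(b)+\eth(a\cdot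 b)$, $a\cdot\eth(b)=\partial(a)\cdot b+\eth(a\cdot b)$, $(\partial\otimes\mathrm{id})\Delta=(\mathrm{id}\otimes\eth)\Delta+\Delta\partial$, $(\mathrm{id}\otimes\partial)\Delta=(\eth\otimes\mathrm{id})\Delta+\Delta\partial$. *)

(* Defs.v *)
From HB Require Import structures.
From mathcomp Require Import all_boot all_order all_algebra.
From mathcomp Require Import sesquilinear.

Set Implicit Arguments.
Unset Strict Implicit.
Unset Printing Implicit Defensive.

Import GRing.Theory.
Local Open Scope ring_scope.

Reserved Notation "u *t v" (at level 40, left associativity).
Reserved Notation "f \ox g" (at level 40, left associativity).

(* The tensor product of two finite-dimensional spaces is modelled by the
   matrices of coefficients with respect to the bases vbasis {:U} and
   vbasis {:V}. [tensor_liftE] and [tensor_lift_uniq] below are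
   its universal property. *)

Definition tensor (F : fieldType) (U V : vectType F) : Type :=
  'M[F]_(\dim {:U}, \dim {:V}).

HB.instance Definition _ (F : fieldType) (U V : vectType F) :=
  Vector.copy (tensor U V) 'M[F]_(\dim {:U}, \dim {:V}).

Section TensorProduct.
Variable F : fieldType.
Implicit Types U V W : vectType F.

Definition tens U V (u : U) (v : V) : tensor U V :=
  \matrix_(i, j) (coord (vbasis {:U}) i u * coord (vbasis {:V}) j v).

Local Notation "u *t v" := (tens u v) : ring_scope.

Fact tens_is_bilinear U V :
  bilinear_for (GRing.Scale.Law.clone F (tensor U V) *:%R _)
    (GRing.Scale.Law.clone F (tensor U V) *:%R _) (@tens U V).
Proof.
split=> [v a u u' | u a v v']; apply/matrixP=> i j; rewrite !mxE linearP /=.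
  by rewrite mulrDl mulrA.
by rewrite mulrDr mulrCA.
Qed.

HB.instance Definition _ U V :=
  bilinear_isBilinear.Build F U V (tensor U V) _ _ (@tens U V)
    (@tens_is_bilinear U V).

(* Linear in t whatever B; it is the map induced by B when B is bilinear. *)
Definition tensor_lift_fun U V W (B : U -> V -> W) (t : tensor U V) : W :=
  \sum_i \sum_j (t : 'M_(_, _)) i j *: B (vbasis {:U})`_i (vbasis {:V})`_j.

Fact tensor_lift_fun_is_linear U V W (B : U -> V -> W) :
  linear (tensor_lift_fun B).
Proof.
move=> a s t; rewrite /tensor_lift_fun scaler_sumr -big_split /=.
apply: eq_bigr => i _; rewrite scaler_sumr -big_split /=.
by apply: eq_bigr => j _; rewrite !mxE scalerA scalerDl.
Qed.

HB.instance Definition _ U V W (B : U -> V -> W) :=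
  GRing.isLinear.Build F (tensor U V) W _ (tensor_lift_fun B)
    (tensor_lift_fun_is_linear B).

Definition tensor_lift U V W (B : U -> V -> W) : 'Hom(tensor U V, W) :=
  linfun (tensor_lift_fun B).

Lemma tensor_liftE U V W (B : {bilinear U -> V -> W}) u v :
  tensor_lift B (u *t v) = B u v.
Proof.
rewrite lfunE /= /tensor_lift_fun.
rewrite [in RHS](coord_vbasis (memvf u)) linear_sumlz.
apply: eq_bigr => i _.
rewrite linearZl_LR [in RHS](coord_vbasis (memvf v)) linear_sumr scaler_sumr.
apply: eq_bigr => j _; rewrite linearZr_LR scalerA; congr (_ *: _).
by rewrite mxE.
Qed.

Lemma tensor_lift_bilinear U V W (B : U -> V -> W) u v :
  bilinear_for (GRing.Scale.Law.clone F W *:%R _)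
    (GRing.Scale.Law.clone F W *:%R _) B ->
  tensor_lift B (u *t v) = B u v.
Proof.
move=> BP; pose b := bilinear_isBilinear.Build F U V W _ _ B BP.
exact: (tensor_liftE (HB.pack_for {bilinear U -> V -> W} B b)).
Qed.

Lemma tensor_lift_uniq U V W (f g : 'Hom(tensor U V, W)) :
  (forall u v, f (u *t v) = g (u *t v)) -> f = g.
Proof.
move=> fg; apply/lfunP => t.
rewrite [t](matrix_sum_delta (t : 'M_(_, _))) !linear_sum.
apply: eq_bigr => i _; rewrite !linear_sum; apply: eq_bigr => j _.
rewrite !linearZ; congr (_ *: _).
suff -> : delta_mx i j = (vbasis {:U})`_i *t (vbasis {:V})`_j by apply: fg.
apply/matrixP => k l; rewrite !mxE !coord_free ?(basis_free (vbasisP _)) //.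
by rewrite -natrM mulnb eq_sym [j == l]eq_sym.
Qed.

Definition tensor_map U U' V V' (f : 'Hom(U, U')) (g : 'Hom(V, V')) :
  'Hom(tensor U V, tensor U' V') := tensor_lift (fun u v => f u *t g v).

Local Notation "f \ox g" := (tensor_map f g) : ring_scope.

Definition tensor_swap U V : 'Hom(tensor U V, tensor V U) :=
  tensor_lift (fun u v => v *t u).

(* The canonical map (U (x) V) (x) W -> U (x) (V (x) W). *)
Definition tensor_assoc U V W :
    'Hom(tensor (tensor U V) W, tensor U (tensor V W)) :=
  tensor_lift (fun t w => tensor_lift (fun u v => u *t (v *t w)) t).

Lemma tensor_mapE U U' V V' (f : 'Hom(U, U')) (g : 'Hom(V, V')) u v :
  (f \ox g) (u *t v) = f u *t g v.
Proof.
by apply: (tensor_lift_bilinear (B := fun x y => f x *t g y));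
  split=> [y a x x' | x a y y'] /=; rewrite linearP ?linearPl ?linearPr.
Qed.

Lemma tensor_swapE U V (u : U) (v : V) : tensor_swap U V (u *t v) = v *t u.
Proof.
by apply: (tensor_lift_bilinear (B := fun x y => y *t x));
  split=> [y a x x' | x a y y'] /=; rewrite ?linearPl ?linearPr.
Qed.

Lemma tensor_assocE U V W (u : U) (v : V) (w : W) :
  tensor_assoc U V W ((u *t v) *t w) = u *t (v *t w).
Proof.
pose C (w' : W) := tensor_lift (fun (x : U) (y : V) => x *t (y *t w')).
have CE w' u' v' : C w' (u' *t v') = u' *t (v' *t w').
  by apply: (tensor_lift_bilinear (B := fun x y => x *t (y *t w')));
    split=> [y a x x' | x a y y'] /=; rewrite ?linearPl ?linearPr.
rewrite -CE; apply: (tensor_lift_bilinear (B := fun t w' => C w' t)).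
split=> [w' a t t' | t a w1 w2] /=; first exact: linearP.
suff -> : C (a *: w1 + w2) = a *: C w1 + C w2 by rewrite add_lfunE scale_lfunE.
apply: tensor_lift_uniq => x y.
by rewrite add_lfunE scale_lfunE !CE !linearPr.
Qed.

End TensorProduct.

Notation "u *t v" := (tens u v) : ring_scope.
Notation "f \ox g" := (tensor_map f g) : ring_scope.

Section ASI.
Variables (F : fieldType) (A : vectType F).
Variables (mul : {bilinear A -> A -> A}) (Delta : 'Hom(A, tensor A A)).
Implicit Types (a b c : A) (d e : 'End(A)).

Definition Lmul a : 'End(A) := linfun (mul a).
Definition Rmul b : 'End(A) := linfun (applyr mul b).

Definition coassociative : Prop :=
  (tensor_assoc A A A \o (Delta \ox \1) \o Delta = (\1 \ox Delta) \o Delta)%VF.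

Record is_ASI_bialgebra : Prop := {
  ASI_mulA : associative mul;
  ASI_coassoc : coassociative;
  ASI_deltaM : forall a b,
    Delta (mul a b)
      = (Rmul b \ox \1%VF) (Delta a) + (\1%VF \ox Lmul a) (Delta b);
  ASI_antisym : forall a b,
    (Lmul a \ox \1%VF - \1%VF \ox Rmul a) (Delta b)
      = tensor_swap A A ((\1%VF \ox Rmul b - Lmul b \ox \1%VF) (Delta a))
}.

Definition is_derivation d : Prop :=
  forall a b, d (mul a b) = mul (d a) b + mul a (d b).

Definition is_coderivation e : Prop :=
  (Delta \o e = (e \ox \1 + \1 \ox e)%R \o Delta)%VF.

Definition is_ASI_derivation d : Prop := is_derivation d /\ is_coderivation d.

Record is_coherent_derivation (de : 'End(A) * 'End(A)) : Prop := {
  coherent_der : is_derivation de.1;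
  coherent_coder : is_coderivation de.2;
  coherent_mull : forall a b, mul (de.2 a) b = mul a (de.1 b) + de.2 (mul a b);
  coherent_mulr : forall a b, mul a (de.2 b) = mul (de.1 a) b + de.2 (mul a b);
  coherent_deltal :
    ((de.1 \ox \1) \o Delta = (((\1 \ox de.2) \o Delta) + (Delta \o de.1))%R)%VF;
  coherent_deltar :
    ((\1 \ox de.1) \o Delta = (((de.2 \ox \1) \o Delta) + (Delta \o de.1))%R)%VF
}.

End ASI.

(* Main.v *)
Require Import Defs.
From HB Require Import structures.
From mathcomp Require Import all_boot all_order all_algebra.
From mathcomp Require Import sesquilinear.

Import GRing.Theory.
Local Open Scope ring_scope.

(** Substituting [- d] for the second component turns each compatibility condition
    into a Leibniz or co-Leibniz rule for [d] with its terms moved across the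
    equality sign. The two compatibilities with the product are thus both the
    derivation rule, and those with the coproduct both the coderivation rule,
    since the tensor product of maps commutes with opposites on either side and
    coderivations are stable under opposite. *)

Lemma tensor_mapNl (F : fieldType) (U U' V V' : vectType F)
    (f : 'Hom(U, U')) (g : 'Hom(V, V')) : (- f) \ox g = - (f \ox g).
Proof.
apply: tensor_lift_uniq => u v.
by rewrite opp_lfunE !tensor_mapE opp_lfunE linearNl.
Qed.

Lemma tensor_mapNr (F : fieldType) (U U' V V' : vectType F)
    (f : 'Hom(U, U')) (g : 'Hom(V, V')) : f \ox (- g) = - (f \ox g).
Proof.
apply: tensor_lift_uniq => u v.
by rewrite opp_lfunE !tensor_mapE opp_lfunE linearNr.
Qed.

Lemma is_coderivationN (F : fieldType) (A : vectType F)
    (Delta : 'Hom(A, tensor A A)) (e : 'End(A)) :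
  is_coderivation Delta (- e) <-> is_coderivation Delta e.
Proof.
rewrite /is_coderivation tensor_mapNl tensor_mapNr -opprD.
by rewrite comp_lfunNl comp_lfunNr; split=> [/oppr_inj | ->].
Qed.

Theorem proposition3p19 (F : fieldType) (charF : [pchar F] =i pred0)
    (A : vectType F) (mul : {bilinear A -> A -> A})
    (Delta : 'Hom(A, tensor A A)) (ASI_A : is_ASI_bialgebra mul Delta)
    (d : 'End(A)) :
  is_ASI_derivation mul Delta d <-> is_coherent_derivation mul Delta (d, - d).
Proof.
split=> [[dM dD] | [/= dM /is_coderivationN dD _ _ _ _]]; last by split.
split=> /=.
- exact: dM.
- exact/is_coderivationN.
- by move=> a b; rewrite !opp_lfunE linearNl dM opprD addrCA subrr addr0.
- by move=> a b; rewrite !opp_lfunE linearNr dM opprD addrA subrr add0r.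
- by rewrite dD tensor_mapNr comp_lfunNl comp_lfunDl addrCA addNr addr0.
- by rewrite dD tensor_mapNl comp_lfunNl comp_lfunDl addKr.
Qed.
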